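(* Let $H$ be a complex Hilbert space, let $A\in B(H)$ be a non-zero positive semidefinite operator, and let $T\in B_{A^{1/2}}(H)$. Then the topological boundary $\partial\sigma_A(T)$ of $\sigma_A(T)$ in $\mathbb C$ satisfies $$\partial\sigma_A(T)\subset \sigma_{A_{app}}(T)\cup\big(\sigma_{A_{app}}(T^{\diamond})\big)^{*},$$ where for $E\subset\mathbb C$, $E^{*}=\{\overline{z}: z\in E\}$ denotes the conjugate set.
   Context: $B(H)$ is the algebra of bounded linear operators on $H$; $R(\cdot)$ denotes range. The seminorm is $\|x\|_A=\langle Ax,x\rangle^{1/2}=\|A^{1/2}x\|$. $B_{A^{1/2}}(H)=\{T\in B(H): R(T^*A^{1/2})\subset R(A^{1/2})\}$; equivalently, those $T\in B(H)$ for which there is $d>0$ with $\|Tx\|_A\le d\|x\|_A$ for all $x\in H$. For $T\in B_{A^{1/2}}(H)$, $T^{\diamond}\in B(H)$ is the unique operator with $T^*A^{1/2}=A^{1/2}T^{\diamond}$ and $R(T^{\diamond})\subset\overline{R(A^{1/2})}$; it also belongs to $B_{A^{1/2}}(H)$. For $T\in B(H)$, the $A$-approximate point spectrum $\sigma_{A_{app}}(T)$ is the set of $\lambda\in\mathbb C$ for which there is a sequence $\{x_n\}$ in $H$ with $\|x_n\|_A=1$ for all $n$ and $\|(T-\lambda)x_n\|_A\to0$. A non-zero operator $T\in B_{A^{1/2}}(H)$ is $A$-invertible in $B_{A^{1/2}}(H)$ if there is a non-zero $S\in B_{A^{1/2}}(H)$ with $ATS=AST=A$. For $T\in B_{A^{1/2}}(H)$,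 $\rho_A(T)=\{\lambda\in\mathbb C:\lambda-T\text{ is }A\text{-invertible in }B_{A^{1/2}}(H)\}$ and the $A$-spectrum is $\sigma_A(T)=\mathbb C\setminus\rho_A(T)$. *)

(* Defs.v *)
From HB Require Import structures.
From mathcomp Require Import all_boot all_order all_algebra.
From mathcomp Require Import sesquilinear complex.
From mathcomp Require Import all_classical all_reals all_analysis.

Set Implicit Arguments.
Unset Strict Implicit.
Unset Printing Implicit Defensive.

Import Order.TTheory GRing.Theory Num.Theory Num.Def.
Import numFieldNormedType.Exports.

Local Open Scope classical_set_scope.
Local Open Scope ring_scope.

Definition boundary (X : topologicalType) (E : set X) : set X :=
  closure E `\` interior E.

Section SemiHilbert.
Context (R : realType) (H : completeNormedModType R[i]).

(* Operators are plain functions [H -> H]; membership in [BH] is what makes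
   them bounded linear operators. *)
Definition BH : set (H -> H) :=
  [set T | linear T /\ exists M : R[i], forall x, `|T x| <= M * `|x|].

(* [dot] is linear in its first argument and conjugate-linear in its second. *)
Context (dot : {dot H for (@conjC R[i])}).

(* [H], which is complete, is a Hilbert space for [dot] when its norm is the
   one that [dot] induces. *)
Definition induces_norm : Prop := forall x : H, `|x| ^+ 2 = dot x x.

(* The order of [R[i]] makes [0 <= z] mean that [z] is real and nonnegative. *)
Definition psd (A : H -> H) : Prop := forall x, 0 <= dot (A x) x.

(* The adjoint, the positive square root and [diamond] below are each the
   unique operator with the stated property; [xget] selects it. It would
   return the zero map if there were none, which does not happen for
   [T] in [BH], for [A] in [BH] positive semidefinite, and for [T] in
   [BAhalf A] respectively. *)
Definition adjoint (T : H -> H) : H -> H :=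
  xget (cst 0) [set S | BH S /\ forall x y, dot (T x) y = dot x (S y)].

Definition sqrtop (A : H -> H) : H -> H :=
  xget (cst 0) [set S | [/\ BH S, psd S & S \o S = A]].

Definition seminormA (A : H -> H) (x : H) : R[i] := sqrtC (dot (A x) x).

Definition BAhalf (A : H -> H) : set (H -> H) :=
  [set T | BH T /\ range (adjoint T \o sqrtop A) `<=` range (sqrtop A)].

Definition diamond (A T : H -> H) : H -> H :=
  xget (cst 0) [set S | [/\ BH S,
                            adjoint T \o sqrtop A = sqrtop A \o S &
                            range S `<=` closure (range (sqrtop A))]].

(* Sets of complex numbers are typed over [R[i]^o], the copy of [R[i]] on which
   the library puts the topology of the modulus. *)
Definition sigmaA_app (A T : H -> H) : set R[i]^o :=
  [set l : R[i]^o | exists x : nat -> H,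
     (forall n, seminormA A (x n) = 1) /\
     (fun n => seminormA A (T (x n) - (l : R[i]) *: x n) : R[i]^o)
       @ \oo --> (0 : R[i]^o)].

Definition A_invertible (A T : H -> H) : Prop :=
  [/\ BAhalf A T, T <> cst 0 &
      exists S, [/\ BAhalf A S, S <> cst 0,
                    A \o T \o S = A & A \o S \o T = A]].

Definition rhoA (A T : H -> H) : set R[i]^o :=
  [set l : R[i]^o | A_invertible A (fun x => (l : R[i]) *: x - T x)].

Definition sigmaA (A T : H -> H) : set R[i]^o := ~` rhoA A T.

End SemiHilbert.

Definition conj_set (R : realType) (E : set R[i]^o) : set R[i]^o :=
  (fun z : R[i] => conjC z) @` E.

(* Main.v *)
(* Write [P = A^(1/2)], so that the [A]-seminorm of [x] is [|P x|]. Suppose that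
   [l] is in neither set on the right, and let [V = l - T]. Then [V] is bounded
   below for the [A]-seminorm, and since [T^* P = P T^diamond], [V^* P] is bounded
   below by a multiple of [P]. Douglas' factorization [P = S^* (V^* P)] then gives
   a bounded [S] with [P V S = P], and the lower bound on [V] gives [P S V = P] and
   the [A]-boundedness of [S], so that [l] is in the resolvent set. Both lower
   bounds persist near [l], so [l] is not even in the closure of the spectrum. *)
Require Import Defs.
From HB Require Import structures.
From mathcomp Require Import all_boot all_order all_algebra.
From mathcomp Require Import sesquilinear complex.
From mathcomp Require Import all_classical all_reals all_analysis.
From mathcomp Require Import ring lra.

Set Implicit Arguments.
Unset Strict Implicit.
Unset Printing Implicit Defensive.

Import Order.TTheory GRing.Theory Num.Theory Num.Def.
Import numFieldNormedType.Exports.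

Local Open Scope classical_set_scope.
Local Open Scope ring_scope.

(** * Real-valued norms *)

Section RealNorm.
Context (R : realType) (V : normedModType R[i]).
Implicit Types (x y : V) (a : R[i]).

(* The library norm of [V] takes values in [R[i]], which is only partially
   ordered. *)
Definition rnorm x : R := complex.Re `|x|.

Lemma rnormE x : (rnorm x)%:C%C = `|x|.
Proof. by rewrite RRe_real ?normr_real. Qed.

Lemma rnorm_ge0 x : 0 <= rnorm x.
Proof. by rewrite -lecR rnormE normr_ge0. Qed.

Lemma rnorm_eq0 x : (rnorm x == 0) = (x == 0).
Proof. by rewrite -(inj_eq (@complexI R)) rnormE normr_eq0. Qed.

Lemma rnorm0 : rnorm 0 = 0.
Proof. by apply/eqP; rewrite rnorm_eq0. Qed.

Lemma rnorm_le0 x : rnorm x <= 0 -> x = 0.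
Proof. by move=> x0; apply/eqP; rewrite -rnorm_eq0 eq_le x0 rnorm_ge0. Qed.

Lemma rnormN x : rnorm (- x) = rnorm x.
Proof. by rewrite /rnorm normrN. Qed.

Lemma rdistC x y : rnorm (x - y) = rnorm (y - x).
Proof. by rewrite /rnorm distrC. Qed.

Lemma rnormD x y : rnorm (x + y) <= rnorm x + rnorm y.
Proof. by rewrite -lecR rmorphD /= !rnormE ler_normD. Qed.

Lemma rnormB x y : rnorm (x - y) <= rnorm x + rnorm y.
Proof. by rewrite -(rnormN y) rnormD. Qed.

Lemma rdistD y x z : rnorm (x - z) <= rnorm (x - y) + rnorm (y - z).
Proof. by rewrite (le_trans _ (rnormD _ _))// addrA subrK. Qed.

Lemma rnormZ a x : rnorm (a *: x) = complex.Re `|a| * rnorm x.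
Proof. by apply: complexI; rewrite rmorphM /= RRe_real ?normr_real// !rnormE normrZ. Qed.

Lemma rnormZr (t : R) x : rnorm (t%:C%C *: x) = `|t| * rnorm x.
Proof. by rewrite rnormZ normc_def /= expr0n /= addr0 sqrtr_sqr. Qed.

Lemma rnorm_ball x (e : R) : ball x e%:C%C = [set y | rnorm (x - y) < e].
Proof.
rewrite -ball_normE; apply/seteqP; split=> y /=; by rewrite -rnormE ltcR.
Qed.

Lemma posc_real (e : R[i]) : 0 < e -> exists2 r : R, 0 < r & e = r%:C%C.
Proof.
move=> e0; exists (complex.Re e); last by rewrite RRe_real ?gtr0_real.
by rewrite -ltcR RRe_real ?gtr0_real.
Qed.

Lemma rnorm_closureP (E : set V) x :
  closure E x <-> forall e : R, 0 < e -> exists2 y, E y & rnorm (x - y) < e.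
Proof.
split=> [clx e e0|clx B]; last first.
  move/nbhs_ballP => [_ /posc_real [e e0 ->]]; rewrite rnorm_ball => eB.
  by have [y Ey xy] := clx e e0; exists y; split=> //; apply: eB.
have [|y [Ey]] := clx (ball x e%:C%C); last by rewrite rnorm_ball => xy; exists y.
by apply: nbhsx_ballx; rewrite ltcR.
Qed.

Lemma rnorm_cvg0 (u : nat -> V) :
  (forall e : R, 0 < e -> exists n0, forall n, (n0 <= n)%N -> rnorm (u n) < e) ->
  u @ \oo --> (0 : V).
Proof.
move=> u0; apply/cvgrPdist_lt => _ /posc_real [e e0 ->].
have [n0 un] := u0 e e0; exists n0 => // n /= n0n.
by rewrite sub0r normrN -rnormE ltcR un.
Qed.

End RealNorm.

Lemma rnorm_cauchy_lim (R : realType) (V : completeNormedModType R[i])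
    (u : nat -> V) :
  (forall e : R, 0 < e -> exists n0, forall m n, (n0 <= m)%N -> (n0 <= n)%N ->
    rnorm (u m - u n) < e) ->
  exists l, forall e : R, 0 < e ->
    exists n0, forall n, (n0 <= n)%N -> rnorm (u n - l) < e.
Proof.
move=> cu; have: cvg (u @ \oo).
  apply: cauchy_cvg; apply/cauchyP => _ /posc_real [e e0 ->].
  have [n0 un] := cu e e0; exists (u n0); rewrite rnorm_ball.
  by exists n0 => // n /= n0n; apply: un.
move=> /cvgrPdist_lt ul; exists (lim (u @ \oo)) => e e0.
have [|n0 _ un] := ul e%:C%C; first by rewrite ltcR.
by exists n0 => n n0n; have := un n n0n; rewrite -rnormE ltcR rdistC.
Qed.

(** * Real part of the inner product *)

Section RealInnerProduct.
Context (R : realType) (H : completeNormedModType R[i]).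
Context (dot : {dot H for (@conjC R[i])}).
Implicit Types (x y z : H) (t : R).

Definition redot x y : R := complex.Re (dot x y).
Local Notation rdot := redot.

Lemma dotC x y : dot x y = conjC (dot y x).
Proof. by rewrite hermC expr0 mul1r. Qed.

Lemma dotZl (a : R[i]) x y : dot (a *: x) y = a * dot x y.
Proof. exact: linearZl_LR. Qed.

Lemma dotBl x y z : dot (x - y) z = dot x z - dot y z.
Proof. exact: linearBl. Qed.

Lemma dotZr (a : R[i]) x y : dot x (a *: y) = conjC a * dot x y.
Proof. by rewrite !(dotC x) dotZl rmorphM. Qed.

Lemma dotBr x y z : dot x (y - z) = dot x y - dot x z.
Proof. by rewrite !(dotC x) dotBl rmorphB. Qed.

Lemma dotDr x y z : dot x (y + z) = dot x y + dot x z.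
Proof. exact: linearDr. Qed.

Lemma rdotC x y : rdot x y = rdot y x.
Proof. by rewrite /redot dotC; case: (dot y x) => a b; reflexivity. Qed.

Lemma rdotDl z x y : rdot (x + y) z = rdot x z + rdot y z.
Proof. by rewrite /redot linearDl raddfD. Qed.

Lemma rdotBl z x y : rdot (x - y) z = rdot x z - rdot y z.
Proof. by rewrite /redot linearBl raddfB. Qed.

Lemma rdotNl x y : rdot (- x) y = - rdot x y.
Proof. by rewrite /redot linearNl raddfN. Qed.

Lemma rdotZl z t x : rdot (t%:C%C *: x) z = t * rdot x z.
Proof.
by rewrite /redot dotZl; case: (dot x z) => a b /=; rewrite mul0r subr0.
Qed.

Lemma rdotDr x y z : rdot x (y + z) = rdot x y + rdot x z.
Proof. by rewrite !(rdotC x) rdotDl. Qed.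

Lemma rdotBr x y z : rdot x (y - z) = rdot x y - rdot x z.
Proof. by rewrite !(rdotC x) rdotBl. Qed.

Lemma rdotZr x t y : rdot x (t%:C%C *: y) = t * rdot x y.
Proof. by rewrite !(rdotC x) rdotZl. Qed.

Lemma rdotil x y : rdot ('i%C *: x) y = - complex.Im (dot x y).
Proof. by rewrite /redot dotZl; case: (dot x y) => a b /=; rewrite mul0r mul1r sub0r. Qed.

Lemma dot_rdotE x y : dot x y = (rdot x y +i* - rdot ('i%C *: x) y)%C.
Proof. by rewrite rdotil opprK /redot; case: (dot x y). Qed.

(** The imaginary part of the inner product is minus its real part at [i x], and linearity moves [i]
    inside [F] and [G]. Estimates can thus be done on real parts alone. *)
Lemma eq_dot (F G : H -> H) y z : linear F -> linear G ->
  (forall x, rdot (F x) y = rdot (G x) z) ->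
  forall x, dot (F x) y = dot (G x) z.
Proof.
move=> lF lG FG x; rewrite !dot_rdotE FG.
have F0 : F 0 = 0 by have := lF (-1) 0 0; rewrite scaler0 addr0 scaleN1r addNr.
have G0 : G 0 = 0 by have := lG (-1) 0 0; rewrite scaler0 addr0 scaleN1r addNr.
have := FG ('i%C *: x).
by have := lF 'i%C x 0; have := lG 'i%C x 0; rewrite F0 G0 !addr0 => -> -> ->.
Qed.

Hypothesis Hdot : induces_norm dot.

Lemma rdotxx x : rdot x x = rnorm x ^+ 2.
Proof.
by apply: complexI; rewrite rmorphXn /= rnormE Hdot RRe_real// ger0_real ?dnorm_ge0.
Qed.

Lemma rnorm_sqrD x y : rnorm (x + y) ^+ 2 = rnorm x ^+ 2 + 2 * rdot x y + rnorm y ^+ 2.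
Proof. by rewrite -!rdotxx rdotDl !rdotDr (rdotC y x); ring. Qed.

Lemma rnorm_sqrB x y : rnorm (x - y) ^+ 2 = rnorm x ^+ 2 - 2 * rdot x y + rnorm y ^+ 2.
Proof. by rewrite rnorm_sqrD rnormN rdotC rdotNl (rdotC y); ring. Qed.

Lemma rdot_le x y : rdot x y <= rnorm x * rnorm y.
Proof.
have [->|x0] := eqVneq x 0; first by rewrite /redot linear0l rnorm0 mul0r.
have [->|y0] := eqVneq y 0; first by rewrite /redot linear0r rnorm0 mulr0.
have x_gt0 : 0 < rnorm x by rewrite lt_neqAle rnorm_ge0 eq_sym rnorm_eq0 x0.
have y_gt0 : 0 < rnorm y by rewrite lt_neqAle rnorm_ge0 eq_sym rnorm_eq0 y0.
(* This square expands to [2 |x| |y| (|x| |y| - rdot x y)]. *)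
have := sqr_ge0 (rnorm ((rnorm y)%:C%C *: x - (rnorm x)%:C%C *: y)).
rewrite -rdotxx rdotBl !rdotBr !rdotZl !rdotZr !rdotxx (rdotC y x).
have := mulr_gt0 x_gt0 y_gt0; nra.
Qed.

Lemma normr_rdot_le x y : `|rdot x y| <= rnorm x * rnorm y.
Proof.
rewrite ler_norml rdot_le andbT lerNl -(rnormN x) (le_trans _ (rdot_le _ _))//.
by rewrite rdotNl.
Qed.

Lemma rdot_eq0 x : (forall y, rdot y x = 0) -> x = 0.
Proof.
by move=> /(_ x)/eqP; rewrite rdotxx expf_eq0 /= rnorm_eq0 => /eqP.
Qed.

Lemma rdot_inj x y : (forall z, rdot z x = rdot z y) -> x = y.
Proof.
by move=> xy; apply/subr0_eq/rdot_eq0 => z; rewrite rdotBr xy subrr.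
Qed.

Lemma dot_inj x y : (forall z, dot z x = dot z y) -> x = y.
Proof. by move=> xy; apply: rdot_inj => z; rewrite /redot xy. Qed.

End RealInnerProduct.

Section LinearPredicate.
Context (K : pzRingType) (U V : lmodType K) (F : U -> V).
Hypothesis lF : linear F.

Let F' : {linear U -> V} := HB.pack F (GRing.isLinear.Build _ _ _ _ _ lF).

Lemma linear_fun0 : F 0 = 0. Proof. exact: (linear0 F'). Qed.
Lemma linear_funN : {morph F : x / - x}. Proof. exact: (linearN F'). Qed.
Lemma linear_funD : {morph F : x y / x + y}. Proof. exact: (linearD F'). Qed.
Lemma linear_funB : {morph F : x y / x - y}. Proof. exact: (linearB F'). Qed.
Lemma linear_funZ a : {morph F : x / a *: x}. Proof. exact: (linearZ_LR F'). Qed.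
End LinearPredicate.

Lemma linear_comp (K : pzRingType) (U V W : lmodType K) (F : V -> W) (G : U -> V) :
  linear F -> linear G -> linear (F \o G).
Proof. by move=> lF lG a x y /=; rewrite lG lF. Qed.

(** Stands in for passing to the limit: error terms may carry a fixed factor [c] of any sign. *)
Lemma le_of_approx (R : realType) (a b c : R) :
  (forall e, 0 < e -> a <= b + e * c) -> a <= b.
Proof.
move=> ab; case: (leP c 0) => c0.
  by have := ab 1 ltr01; lra.
apply/ler_addgt0Pr => e e0; have := ab (e / c) (divr_gt0 e0 c0).
by rewrite divfK ?gt_eqF.
Qed.

Lemma discriminant_le (R : realFieldType) (a b c : R) : 0 <= a ->
  (forall t, 0 <= c + 2 * t * b + t ^+ 2 * a) -> b ^+ 2 <= c * a.
Proof.
rewrite le_eqVlt => /predU1P[<-|a0] tP; last first.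
  (* The minimiser of the quadratic. *)
  have := tP (- b / a); rewrite -(@pmulr_rge0 _ a)//.
  suff -> : a * (c + 2 * (- b / a) * b + (- b / a) ^+ 2 * a) = c * a - b ^+ 2.
    by rewrite subr_ge0.
  by field; rewrite gt_eqF.
rewrite mulr0; have [->|b0] := eqVneq b 0; first by rewrite expr0n.
(* With [a = 0] and [b <> 0] the expression is affine in [t]; this [t] gives it the value -1. *)
have := tP (- (c + 1) / (2 * b)).
suff -> : c + 2 * (- (c + 1) / (2 * b)) * b + (- (c + 1) / (2 * b)) ^+ 2 * 0 = -1.
  by lra.
by field.
Qed.

(** * Bounded operators *)

Section Bounded.
Context (R : realType) (H : completeNormedModType R[i]).
Implicit Types T : H -> H.

Lemma BH_bound T : BH T -> exists2 c : R, 0 < c & forall x, rnorm (T x) <= c * rnorm x.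
Proof.
(* [M] is complex, and comparing real parts leaves only [Re M]; adding 1 makes the constant
   positive. *)
move=> [_ [M TM]]; exists (`|complex.Re M| + 1) => [|x].
  by rewrite ltr_wpDl.
have : rnorm (T x) <= complex.Re (M * `|x|).
  by have := TM x; rewrite lecE => /andP[].
rewrite -rnormE; case: (M) => a b /=; rewrite mulr0 subr0 => /le_trans; apply.
by have := ler_norm a; have := rnorm_ge0 x; nra.
Qed.

Lemma BH_intro T (c : R) : linear T -> (forall x, rnorm (T x) <= c * rnorm x) -> BH T.
Proof.
move=> lT Tc; split=> //; exists c%:C%C => x.
by rewrite -!rnormE -rmorphM /= lecR.
Qed.

Lemma BH_comp T U : BH T -> BH U -> BH (T \o U).
Proof.
move=> BT BU; have [c c0 Tc] := BH_bound BT; have [d d0 Ud] := BH_bound BU.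
apply: (@BH_intro _ (c * d)) => [|x]; first exact: linear_comp (proj1 BT) (proj1 BU).
by rewrite (le_trans (Tc _))// -mulrA ler_pM2l.
Qed.

Lemma BH_scaleB (l : R[i]) T : BH T -> BH (fun x => l *: x - T x).
Proof.
move=> BT; have [c c0 Tc] := BH_bound BT.
apply: (@BH_intro _ (complex.Re `|l| + c)) => [a x y|x].
  by rewrite (proj1 BT) scalerDr scalerBr !scalerA mulrC opprD addrACA.
by rewrite (le_trans (rnormB _ _))// mulrDl rnormZ lerD2l.
Qed.

Lemma closure_range_linear T a x y : BH T -> closure (range T) x ->
  closure (range T) y -> closure (range T) (a *: x + y).
Proof.
move=> BT /rnorm_closureP clx /rnorm_closureP cly; apply/rnorm_closureP => e e0.
set k := complex.Re `|a|; have k0 : 0 <= k by rewrite -lecR RRe_real ?normr_real ?normr_ge0.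
(* [k + 1] replaces [k] as divisor because [a] may be 0. *)
have k1 : 0 < 2 * (k + 1) by lra.
have [_ [x' _ <-] xx'] := clx (e / (2 * (k + 1))) (divr_gt0 e0 k1).
have [|_ [y' _ <-] yy'] := cly (e / 2); first by rewrite divr_gt0.
exists (T (a *: x' + y')); first by exists (a *: x' + y').
rewrite (proj1 BT) opprD addrACA -scalerBr (le_lt_trans (rnormD _ _))//.
rewrite rnormZ -/k; move: xx'; rewrite ltr_pdivlMr// => xx'.
have := rnorm_ge0 (x - T x'); nra.
Qed.

End Bounded.

(** * Douglas factorization *)

Section Douglas.
Context (R : realType) (H : completeNormedModType R[i]).
Context (dot : {dot H for (@conjC R[i])}) (Hdot : induces_norm dot).
Local Notation rdot := (redot dot).

(** If [L x] is within [e] of [u], then [|u|^2 = <u - L x, u> + <L x, u>] in real parts is at most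
    [e |u| + |k| (|u| + e)]. *)
Lemma closure_range_norm_le (L : H -> H) (u : H) (k : R) : closure (range L) u ->
  (forall x, rdot (L x) u <= k * rnorm (L x)) -> rnorm u <= `|k|.
Proof.
move=> /rnorm_closureP clu uk; have [u0|u0] := leP (rnorm u) 0.
  exact: le_trans u0 _.
suff : rnorm u * rnorm u <= `|k| * rnorm u by rewrite ler_pM2r.
apply: (@le_of_approx _ _ _ (rnorm u + `|k|)) => e e0.
have [_ [x _ <-] ux] := clu e e0.
have -> : rnorm u * rnorm u = rdot (u - L x) u + rdot (L x) u.
  by rewrite -rdotDl subrK rdotxx.
have := rdot_le Hdot (u - L x) u; have := uk x; have := ler_norm k.
have := rdistD u (L x) 0; rewrite !subr0 rdistC => Lx.
have := rnorm_ge0 (L x); have := normr_ge0 k; nra.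
Qed.

Lemma closure_range_orth (L : H -> H) (u : H) : closure (range L) u ->
  (forall x, rdot (L x) u = 0) -> u = 0.
Proof.
move=> clu u0; apply: rnorm_le0; rewrite -(normr0 R).
by apply: (closure_range_norm_le clu) => x; rewrite u0 mul0r.
Qed.

(* The representing vector is the limit of [L x_n] along a minimising sequence
   of [|L x|^2 - 2 Re <F x, h>], which is Cauchy by the parallelogram law. *)
Lemma riesz_range (F L : H -> H) (k : R) (h : H) : linear F -> linear L ->
  (forall x, `|rdot (F x) h| <= k * rnorm (L x)) ->
  exists2 u, closure (range L) u & forall x, rdot (F x) h = rdot (L x) u.
Proof.
move=> lF lL Fk.
pose g x := rnorm (L x) ^+ 2 - 2 * rdot (F x) h.
have g_lb : has_lbound (range g).
  (* By hypothesis [g x >= |L x|^2 - 2 k |L x| = (|L x| - k)^2 - k^2]. *)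
  exists (- k ^+ 2) => _ [x _ <-]; rewrite /g.
  have := Fk x; rewrite ler_norml => /andP[_].
  have := sqr_ge0 (rnorm (L x) - k); nra.
have g_inf : has_inf (range g) by split=> //; exists (g 0), 0.
set m := inf (range g).
have mg x : m <= g x by apply: ge_inf => //; exists x.
have /choice [xs xsP] : forall n : nat, exists x, g x < m + n.+1%:R^-1.
  move=> n; have [|_ [x _ <-] xm] := @inf_adherent _ _ n.+1%:R^-1 _ g_inf.
    by rewrite invr_gt0.
  by exists x.
have parallelogram x y :
    rnorm (L x - L y) ^+ 2 <= 2 * (g x - m) + 2 * (g y - m).
  (* The infimum is compared with the value of [g] at the midpoint. *)
  have := mg ((2^-1 : R)%:C%C *: (x + y)); rewrite /g (linear_funZ lL) (linear_funZ lF) rnormZr.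
  rewrite rdotZl (linear_funD lL) (linear_funD lF) rdotDl exprMn real_normK ?num_real//.
  rewrite (rnorm_sqrB Hdot) (rnorm_sqrD Hdot); lra.
have small (e : R) : 0 < e -> exists n0, forall n, (n0 <= n)%N -> n.+1%:R^-1 < e.
  move=> e0; exists (Num.truncn e^-1) => n n0.
  rewrite -ltf_pV2 ?posrE ?invrK ?invr_gt0//.
  by rewrite (lt_le_trans (truncnS_gt _))// ler_nat.
have [u uP] : exists u, forall e : R, 0 < e ->
    exists n0, forall n, (n0 <= n)%N -> rnorm (L (xs n) - u) < e.
  apply: rnorm_cauchy_lim => e e0.
  have [|n0 n0P] := small (e ^+ 2 / 4); first by rewrite divr_gt0 ?exprn_gt0.
  exists n0 => p q /n0P ep /n0P eq.
  rewrite -(@ltr_pXn2r _ 2) ?nnegrE ?rnorm_ge0 ?ltW//.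
  have gp : g (xs p) < m + e ^+ 2 / 4 by rewrite (lt_trans (xsP p))// ltrD2l.
  have gq : g (xs q) < m + e ^+ 2 / 4 by rewrite (lt_trans (xsP q))// ltrD2l.
  have := parallelogram (xs p) (xs q); lra.
exists u.
  apply/rnorm_closureP => e /uP [n0 /(_ n0 (leqnn _))].
  by rewrite rdistC => un; exists (L (xs n0)) => //; exists (xs n0).
move=> z; apply/eqP; rewrite -subr_eq0 -normr_le0.
apply: (@le_of_approx _ _ _ (2 * rnorm (L z))) => e e0; rewrite add0r.
have [n1 n1P] := uP e e0.
have [|n2 n2P] := small (e ^+ 2); first by rewrite exprn_gt0.
pose n := maxn n1 n2; have {n1P} un := n1P n (leq_maxl _ _).
have {n2P} en := n2P n (leq_maxr _ _).
set b := rdot (L (xs n)) (L z) - rdot (F z) h.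
(* First variation: [g (xs n + t z) - g (xs n) = 2 t b + t^2 |L z|^2], and it exceeds [- e^2]
   because [xs n] is within [e^2] of the infimum. The discriminant then makes [b] small. *)
have quad t : 0 <= e ^+ 2 + 2 * t * b + t ^+ 2 * rnorm (L z) ^+ 2.
  have gn : g (xs n) < m + e ^+ 2 by rewrite (lt_trans (xsP n))// ltrD2l.
  have := mg (xs n + t%:C%C *: z); move: gn.
  rewrite /g (linear_funD lL) (linear_funD lF) (linear_funZ lL) (linear_funZ lF).
  rewrite (rnorm_sqrD Hdot) rdotDl rdotZl rdotZr.
  rewrite rnormZr exprMn real_normK ?num_real// /b; lra.
have b_le : `|b| <= e * rnorm (L z).
  rewrite -(@ler_pXn2r _ 2) ?nnegrE ?mulr_ge0 ?rnorm_ge0 ?(ltW e0)//.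
  by rewrite real_normK ?num_real// exprMn; apply: discriminant_le quad; apply: sqr_ge0.
have -> : rdot (F z) h - rdot (L z) u = rdot (L (xs n) - u) (L z) - b.
  by rewrite /b rdotBl (rdotC _ u); ring.
have := normr_rdot_le Hdot (L (xs n) - u) (L z).
have := ler_normB (rdot (L (xs n) - u) (L z)) b.
have := rnorm_ge0 (L z); nra.
Qed.

(** This is [F = G^* L]. Each [G h] represents the functional [<F x, h>] through [L] by
    [riesz_range]. A vector of the closed range of [L] is determined by its products with the [L x],
    whence linearity; the same products bound its norm. *)
Lemma douglas_factor (F L : H -> H) (c : R) : BH F -> BH L ->
  (forall x, rnorm (F x) <= c * rnorm (L x)) ->
  exists G, [/\ BH G, range G `<=` closure (range L) &
    forall x h, dot (F x) h = dot (L x) (G h)].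
Proof.
move=> BF BL Fc; have [lF lL] := (proj1 BF, proj1 BL).
have Fh h x : `|rdot (F x) h| <= c * rnorm h * rnorm (L x).
  rewrite (le_trans (normr_rdot_le Hdot _ _))// mulrAC.
  by rewrite ler_wpM2r ?rnorm_ge0.
have /choice [G GP] : forall h, exists u, closure (range L) u /\
    forall x, rdot (F x) h = rdot (L x) u.
  by move=> h; have [u ? ?] := riesz_range lF lL (Fh h); exists u.
have FG h := eq_dot lF lL (proj2 (GP h)).
have lG : linear G.
  move=> a x y; apply/subr0_eq/(@closure_range_orth L) => [|z].
    rewrite [_ - _]addrC -scaleN1r; apply: closure_range_linear => //.
      by apply: closure_range_linear => //; apply: (proj1 (GP _)).
    exact: (proj1 (GP _)).
  by rewrite /redot dotBr -FG !dotDr !dotZr -!FG subrr.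
exists G; split.
- apply: (@BH_intro _ _ _ `|c|) => // h.
  have := closure_range_norm_le (proj1 (GP h)) (k := c * rnorm h).
  rewrite normrM (ger0_norm (rnorm_ge0 h)); apply=> x.
  by rewrite -(proj2 (GP h)) (le_trans (ler_norm _)).
- by move=> _ [h _ <-]; apply: (proj1 (GP h)).
- by move=> x h; apply: FG.
Qed.
End Douglas.

(** * Uniform boundedness *)

Lemma exists_expr_lt (R : realType) (q : R) : 0 <= q < 1 -> forall e, 0 < e -> exists n, q ^+ n < e.
Proof.
move=> /andP[q0 q1] e e0; have q1' : `|q| < 1 by rewrite ger0_norm.
have /cvgrPdist_lt /(_ e e0) [n _ /(_ n (leqnn _))] := cvg_expr q1'.
by rewrite sub0r normrN normrX ger0_norm // => ?; exists n.
Qed.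

Section UniformBoundedness.
Context (R : realType) (H : completeNormedModType R[i]).
Context (dot : {dot H for (@conjC R[i])}) (Hdot : induces_norm dot).
Local Notation rdot := (redot dot).

(* Gliding hump: signs are chosen so that [x = \sum_n +/- 3^-n v_n / |v_n|]
   satisfies [|<x, v_n>| >= 3^-n |v_n| / 2]. *)
Lemma gliding_hump (v : nat -> H) :
  exists x, forall n, 3^-1 ^+ n * rnorm (v n) <= 2 * `|rdot x (v n)|.
Proof.
(* When [v n = 0] the quotient is 0 and so is [e n]; the two facts below still hold. *)
pose e n := (3^-1 ^+ n / rnorm (v n))%:C%C *: v n.
have q_ge0 n : 0 <= (3^-1 : R) ^+ n by rewrite exprn_ge0.
have e_le n : rnorm (e n) <= 3^-1 ^+ n.
  rewrite rnormZr ger0_norm ?divr_ge0 ?rnorm_ge0//.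
  have [->|v0] := eqVneq (rnorm (v n)) 0; first by rewrite mulr0.
  by rewrite divfK.
have e_dot n : rdot (e n) (v n) = 3^-1 ^+ n * rnorm (v n).
  rewrite rdotZl rdotxx//.
  have [->|v0] := eqVneq (rnorm (v n)) 0; first by rewrite !(mulr0, expr0n).
  by rewrite expr2 mulrA divfK.
pose X := fix X n := if n is n'.+1 then
  if 0 <= rdot (X n') (v n') then X n' + e n' else X n' - e n' else 0.
have X_step n : rnorm (X n.+1 - X n) <= 3^-1 ^+ n.
  rewrite /=; case: ifP => _; last rewrite -rnormN opprB subKr.
    by rewrite addrAC subrr add0r.
  exact: e_le.
(* The sign of the new term agrees with that of [rdot (X n) (v n)], so nothing cancels. *)
have X_dot n : 3^-1 ^+ n * rnorm (v n) <= `|rdot (X n.+1) (v n)|.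
  have := mulr_ge0 (q_ge0 n) (rnorm_ge0 (v n)).
  rewrite /=; case: ifPn => [X0|].
    by rewrite rdotDl e_dot => ?; rewrite ger0_norm; lra.
  by rewrite -ltNge rdotBl e_dot => *; rewrite ltr0_norm; lra.
have X_tail n k : rnorm (X (n + k)%N - X n) <= 3 / 2 * (3^-1 ^+ n - 3^-1 ^+ (n + k)).
  elim: k => [|k IH]; first by rewrite addn0 !subrr rnorm0 mulr0.
  have := rdistD (X (n + k)%N) (X (n + k.+1)%N) (X n).
  by rewrite addnS; have := X_step (n + k)%N; rewrite exprS; lra.
have X_tail_le n m : (n <= m)%N -> rnorm (X m - X n) <= 3 / 2 * 3^-1 ^+ n.
  by move=> /subnKC <-; have := X_tail n (m - n)%N; have := q_ge0 (n + (m - n))%N; lra.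
have [x xP] : exists l, forall e : R, 0 < e ->
    exists n0, forall n, (n0 <= n)%N -> rnorm (X n - l) < e.
  apply: rnorm_cauchy_lim => d d0.
  have [||n qn] := @exists_expr_lt R 3^-1 _ (d / 3); [lra|lra|].
  exists n => p q np nq.
  have := rdistD (X n) (X p) (X q); rewrite (rdistC (X n)).
  have := X_tail_le _ _ np; have := X_tail_le _ _ nq; lra.
exists x => n.
(* The geometric tail [3/2 * 3^-(n+1)] is half of [3^-n], so later terms destroy at most half of the
   hump at [n]. *)
have x_tail : rnorm (x - X n.+1) <= 2^-1 * 3^-1 ^+ n.
  apply: (@le_of_approx _ _ _ 1) => d d0; have [n0 n0P] := xP d d0.
  pose m := maxn n0 n.+1; have := n0P m (leq_maxl _ _).
  have := X_tail_le _ _ (leq_maxr n0 n.+1); rewrite exprS.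
  have := rdistD (X m) x (X n.+1); rewrite (rdistC x (X m)); lra.
have -> : rdot x (v n) = rdot (X n.+1) (v n) + rdot (x - X n.+1) (v n).
  by rewrite -rdotDl addrC subrK.
have := normr_rdot_le Hdot (x - X n.+1) (v n).
have := ler_wpM2r (rnorm_ge0 (v n)) x_tail.
have := X_dot n.
have := lerB_normD (rdot (X n.+1) (v n)) (rdot (x - X n.+1) (v n)); lra.
Qed.

(** Otherwise pick [i n] with [|v (i n)| > 2 n 3^n w (i n)]; the gliding hump gives an [x] with
    [|<x, v (i n)>| > n w (i n)] for all [n], against the bound at [x] once [n > M]. The weight
    stays explicit since it will be [|P z|], which can vanish. *)
Lemma uniform_boundedness (I : Type) (v : I -> H) (w : I -> R) :
  (forall i, 0 <= w i) ->
  (forall x, exists M, forall i, `|rdot x (v i)| <= M * w i) ->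
  exists2 c, 0 <= c & forall i, rnorm (v i) <= c * w i.
Proof.
move=> w0 vw; apply: contrapT => unbounded.
have /choice [i iP] : forall n : nat, exists i, 2 * n%:R * 3 ^+ n * w i < rnorm (v i).
  move=> n; apply: contrapT => ni; apply: unbounded.
  exists (2 * n%:R * 3 ^+ n) => [|j]; first by rewrite mulr_ge0// exprn_ge0.
  by rewrite leNgt; apply/negP => vj; apply: ni; exists j.
have [x xP] := gliding_hump (v \o i); have [M MP] := vw x.
pose n := (Num.truncn M).+1; have Mn : M < n%:R by apply: truncnS_gt.
have := xP n; apply/negP; rewrite -ltNge /=.
have : 0 < (3^-1 : R) ^+ n by rewrite exprn_gt0.
move=> q0; rewrite (le_lt_trans _ (_ : 3^-1 ^+ n * (2 * n%:R * 3 ^+ n * w (i n)) < _))//.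
  have -> : 3^-1 ^+ n * (2 * n%:R * 3 ^+ n * w (i n)) = 2 * n%:R * w (i n).
    by rewrite exprVn; field; rewrite expf_neq0.
  have := MP (i n); have := w0 (i n); nra.
by rewrite ltr_pM2l.
Qed.

End UniformBoundedness.

(** * Positive square roots *)

Section SquareRoot.
Context (R : realType) (H : completeNormedModType R[i]).
Context (dot : {dot H for (@conjC R[i])}) (Hdot : induces_norm dot).
Local Notation rdot := (redot dot).

(** Symmetry tested at [i x] equates the imaginary part with its opposite. *)
Lemma Im_dot_real (A : H -> H) x : linear A ->
  (forall y, rdot (A x) y = rdot x (A y)) ->
  (forall y, rdot (A y) x = rdot y (A x)) -> complex.Im (dot (A x) x) = 0.
Proof.
move=> lA Ax Ay; have := Ay ('i%C *: x).
rewrite (linear_funZ lA) !rdotil dotC.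
by case: (dot x (A x)) => a b /=; rewrite opprK; lra.
Qed.

Lemma psd_rdot (A : H -> H) x : psd dot A -> 0 <= rdot (A x) x.
Proof. by move=> /(_ x); rewrite lecE => /andP[]. Qed.

(** Positivity makes [<A z, z>] real. Polarising at [u + v] gives [Im <A u, v> + Im <A v, u> = 0],
    and [u = i x], [v = y] turns imaginary parts into real ones. *)
Lemma psd_sym (A : H -> H) x y : linear A -> psd dot A ->
  rdot (A x) y = rdot x (A y).
Proof.
move=> lA pA.
have Im0 z : complex.Im (dot (A z) z) = 0.
  by have := pA z; rewrite lecE => /andP[/eqP].
have Im_add u v : complex.Im (dot (A u) v) + complex.Im (dot (A v) u) = 0.
  have := Im0 (u + v); rewrite (linear_funD lA) !(linearDl, dotDr) !raddfD /=.
  by rewrite !Im0; lra.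
have := Im_add ('i%C *: x) y.
rewrite (linear_funZ lA) dotZl dotZr (rdotC _ x) /redot.
by case: (dot (A x) y) (dot (A y) x) => [a b] [c d] /=; lra.
Qed.

(* The scalar iteration [y' = (1 + y^2) / 2] majorises the operator iteration
   [Y' = (B + Y^2) / 2] of a contraction [B], increments included. *)
Definition sqrt_majorant := fix y n : R :=
  if n is n'.+1 then 2^-1 * (1 + y n' ^+ 2) else 0.

Lemma sqrt_majorant_bound n :
  0 <= sqrt_majorant n <= sqrt_majorant n.+1 /\ sqrt_majorant n.+1 <= 1.
Proof. by elim: n => [|n] /=; nra. Qed.

Lemma sqrt_majorant_homo m n : (m <= n)%N -> sqrt_majorant m <= sqrt_majorant n.
Proof.
move=> /subnKC <-; elim: (n - m)%N => [|k IH]; first by rewrite addn0.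
by rewrite addnS; have := sqrt_majorant_bound (m + k); lra.
Qed.

Lemma sqrt_majorant_cauchy : exists s, s <= 1 /\
  (forall n, sqrt_majorant n <= s) /\
  forall e, 0 < e -> exists n0, s - sqrt_majorant n0 < e.
Proof.
have hs : has_sup (range sqrt_majorant).
  split; first by exists 0, 0%N.
  by exists 1 => _ [n _ <-]; have := sqrt_majorant_bound n; lra.
exists (sup (range sqrt_majorant)); split; [|split].
- apply: ge_sup; first by exists 0, 0%N.
  by move=> _ [n _ <-]; have := sqrt_majorant_bound n; lra.
- by move=> n; apply: ub_le_sup; [case: hs|exists n].
- move=> e e0; have [_ [n _ <-] yn] := sup_adherent e0 hs.
  by exists n; lra.
Qed.

(** * The square root iteration for a symmetric contraction *)

Section Contraction.
Variable B : H -> H.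
Hypotheses (lB : linear B) (Ble : forall x, rnorm (B x) <= rnorm x).
Hypothesis (symB : forall x y, rdot (B x) y = rdot x (B y)).

Local Notation half := ((2^-1 : R)%:C%C).

(** A fixed point [Y = (B + Y^2) / 2] satisfies [(1 - Y)^2 = 1 - B], so the limit provides a square
    root of [1 - B]. *)
Definition sqrt_iter := fix Y n : H -> H :=
  if n is n'.+1 then fun x => half *: (B x + Y n' (Y n' x)) else fun=> 0.

Lemma sqrt_iterS n x : sqrt_iter n.+1 x = half *: (B x + sqrt_iter n (sqrt_iter n x)).
Proof. by []. Qed.

Lemma sqrt_iter_linear n : linear (sqrt_iter n).
Proof.
elim: n => [|n IH] a x y /=; first by rewrite scaler0 addr0.
rewrite lB !IH scalerA [a * _]mulrC -scalerA -scalerDr; congr (_ *: _).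
by rewrite scalerDr addrACA.
Qed.

Lemma sqrt_iter_sym n x y : rdot (sqrt_iter n x) y = rdot x (sqrt_iter n y).
Proof.
elim: n x y => [|n IH] x y /=; first by rewrite /redot linear0l linear0r.
by rewrite rdotZl rdotZr rdotDl rdotDr symB !IH.
Qed.

(** The iterates are polynomials in [B]. Their commuting with one another is what lets a difference
    of squares of iterates factor. *)
Lemma sqrt_iter_comm n (C : H -> H) : linear C -> (forall x, C (B x) = B (C x)) ->
  forall x, C (sqrt_iter n x) = sqrt_iter n (C x).
Proof.
move=> lC CB; elim: n => [|n IH] x /=; first exact: linear_fun0.
by rewrite (linear_funZ lC) (linear_funD lC) CB !IH.
Qed.

Lemma sqrt_iter_comm_iter m n x :
  sqrt_iter m (sqrt_iter n x) = sqrt_iter n (sqrt_iter m x).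
Proof.
apply: sqrt_iter_comm => [|{}x]; first exact: sqrt_iter_linear.
by symmetry; apply: sqrt_iter_comm.
Qed.

Lemma sqrt_iter_norm n x : rnorm (sqrt_iter n x) <= sqrt_majorant n * rnorm x.
Proof.
elim: n x => [|n IH] x /=; first by rewrite rnorm0 mul0r.
rewrite rnormZr ger0_norm// -mulrA ler_pM2l//.
rewrite (le_trans (rnormD _ _))// mulrDl mul1r lerD//.
have [/andP[y0 _] _] := sqrt_majorant_bound n.
by rewrite (le_trans (IH _))// expr2 -mulrA ler_wpM2l.
Qed.

(** The next increment is [(Y' - Y) (Y' + Y) / 2] for consecutive iterates [Y], [Y']; the majorant
    obeys the same identity, so the induction bounds factor by factor. *)
Lemma sqrt_iter_step n x : rnorm (sqrt_iter n.+1 x - sqrt_iter n x) <=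
  (sqrt_majorant n.+1 - sqrt_majorant n) * rnorm x.
Proof.
elim: n x => [|n IH] x.
  rewrite [sqrt_majorant 1]/= [sqrt_iter 1 x]/= addr0 !subr0 rnormZr expr0n /= addr0 mulr1.
  by rewrite ger0_norm// ler_pM2l.
have -> : sqrt_iter n.+2 x - sqrt_iter n.+1 x =
    half *: (sqrt_iter n.+1 (sqrt_iter n.+1 x + sqrt_iter n x) -
             sqrt_iter n (sqrt_iter n.+1 x + sqrt_iter n x)).
  rewrite (sqrt_iterS n.+1) [X in _ - X]sqrt_iterS -scalerBr opprD addrACA subrr add0r.
  rewrite !(linear_funD (sqrt_iter_linear _)) (sqrt_iter_comm_iter n.+1 n).
  by rewrite opprD addrACA addrA subrK.
have [/andP[y0 y1] y2] := sqrt_majorant_bound n.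
rewrite rnormZr ger0_norm//.
have sum_le : rnorm (sqrt_iter n.+1 x + sqrt_iter n x) <=
    (sqrt_majorant n.+1 + sqrt_majorant n) * rnorm x.
  by rewrite mulrDl (le_trans (rnormD _ _))// lerD// sqrt_iter_norm.
have y'y : 0 <= sqrt_majorant n.+1 - sqrt_majorant n by rewrite subr_ge0.
have := IH (sqrt_iter n.+1 x + sqrt_iter n x); have := ler_wpM2l y'y sum_le.
have -> : sqrt_majorant n.+2 = 2^-1 * (1 + sqrt_majorant n.+1 ^+ 2) by [].
have : sqrt_majorant n.+1 = 2^-1 * (1 + sqrt_majorant n ^+ 2) by [].
move: (sqrt_majorant n.+1) (sqrt_majorant n) => y' y yE; move: yE (rnorm x) => yE r.
have -> : 2^-1 * (1 + y' ^+ 2) - y' = 2^-1 * (y' - y) * (y' + y) by rewrite {2}yE; ring.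
lra.
Qed.

Lemma sqrt_iter_dist m n x : (m <= n)%N -> rnorm (sqrt_iter n x - sqrt_iter m x) <=
  (sqrt_majorant n - sqrt_majorant m) * rnorm x.
Proof.
move=> /subnKC <-; elim: (n - m)%N => [|k IH].
  by rewrite addn0 !subrr rnorm0 mul0r.
have := rdistD (sqrt_iter (m + k) x) (sqrt_iter (m + k.+1) x) (sqrt_iter m x).
by rewrite addnS; have := sqrt_iter_step (m + k) x; lra.
Qed.

Lemma sqrt_iter_limit : exists Y : H -> H, [/\ linear Y,
  forall x, rnorm (Y x) <= rnorm x,
  forall x y, rdot (Y x) y = rdot x (Y y) &
  forall x, Y x = half *: (B x + Y (Y x))].
Proof.
have [s [s1 [ys s_adh]]] := sqrt_majorant_cauchy.
have s0 : 0 <= s := ys 0%N.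
have /choice [Y YP] : forall x, exists l, forall e : R, 0 < e ->
    exists n0, forall n, (n0 <= n)%N -> rnorm (sqrt_iter n x - l) < e.
  move=> x; apply: rnorm_cauchy_lim => e e0.
  have x1 : 0 < rnorm x + 1 by rewrite ltr_wpDl ?rnorm_ge0.
  have [n0 n0P] := s_adh _ (divr_gt0 e0 x1).
  move: n0P; rewrite ltr_pdivlMr// => n0P.
  exists n0 => m n m0 n0'.
  wlog mn : m n m0 n0' / (m <= n)%N.
    move=> W; have [|/ltnW] := leqP m n; first exact: W.
    by rewrite rdistC; apply: W.
  rewrite rdistC (le_lt_trans (sqrt_iter_dist _ mn))//.
  have := sqrt_majorant_homo m0; have := ys n; have := ys m; have := ys n0.
  have := rnorm_ge0 x; nra.
have Ydist n x : rnorm (Y x - sqrt_iter n x) <= (s - sqrt_majorant n) * rnorm x.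
  apply: (@le_of_approx _ _ _ 1) => e e0; have [n0 n0P] := YP x e e0.
  pose m := maxn n0 n; have := n0P m (leq_maxl _ _).
  have := sqrt_iter_dist x (leq_maxr n0 n); rewrite -/m.
  have := rdistD (sqrt_iter m x) (Y x) (sqrt_iter n x).
  rewrite (rdistC (Y x) (sqrt_iter m x)).
  have := ys m; have := rnorm_ge0 x; nra.
(* Each property of [Y] below is read off from the iterates, with an error of the form
   [(s - sqrt_majorant n) * c]. *)
have squeeze (a c : R) : 0 <= c ->
    (forall n, a <= (s - sqrt_majorant n) * c) -> a <= 0.
  move=> c0 ac; apply: (@le_of_approx _ _ _ c) => e e0.
  have [n nP] := s_adh e e0; have := ac n; nra.
have Yle x : rnorm (Y x) <= rnorm x.
  rewrite -subr_le0; apply: (squeeze _ (rnorm x) (rnorm_ge0 x)) => n.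
  have := rdistD (sqrt_iter n x) (Y x) 0; rewrite !subr0.
  have := Ydist n x; have := sqrt_iter_norm n x; have := ys n.
  have := rnorm_ge0 x; nra.
exists Y; split => //.
- move=> a x y; apply/subr0_eq/rnorm_le0.
  set k := complex.Re `|a|.
  have k0 : 0 <= k by rewrite -lecR RRe_real ?normr_real ?normr_ge0.
  apply: (squeeze _ (rnorm (a *: x + y) + k * rnorm x + rnorm y)) => [|n].
    by rewrite !addr_ge0 ?mulr_ge0 ?rnorm_ge0.
  have -> : Y (a *: x + y) - (a *: Y x + Y y) =
      (Y (a *: x + y) - sqrt_iter n (a *: x + y)) -
      (a *: (Y x - sqrt_iter n x) + (Y y - sqrt_iter n y)).
    by rewrite sqrt_iter_linear scalerBr addrACA -opprD opprB [RHS]addrA subrK.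
  have := rnormB (Y (a *: x + y) - sqrt_iter n (a *: x + y))
      (a *: (Y x - sqrt_iter n x) + (Y y - sqrt_iter n y)).
  have := rnormD (a *: (Y x - sqrt_iter n x)) (Y y - sqrt_iter n y).
  rewrite rnormZ -/k; have := ler_wpM2l k0 (Ydist n x).
  have := Ydist n (a *: x + y); have := Ydist n y; lra.
- move=> x y; apply/eqP; rewrite -subr_eq0 -normr_le0.
  apply: (squeeze _ (2 * (rnorm x * rnorm y))) => [|n].
    by rewrite !mulr_ge0 ?rnorm_ge0.
  have -> : rdot (Y x) y - rdot x (Y y) =
      rdot (Y x - sqrt_iter n x) y - rdot x (Y y - sqrt_iter n y).
    by rewrite rdotBl rdotBr sqrt_iter_sym; lra.
  rewrite (le_trans (ler_normB _ _))//.
  have := normr_rdot_le Hdot (Y x - sqrt_iter n x) y.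
  have := normr_rdot_le Hdot x (Y y - sqrt_iter n y).
  have := ler_wpM2r (rnorm_ge0 y) (Ydist n x).
  have := ler_wpM2l (rnorm_ge0 x) (Ydist n y).
  lra.
- move=> x; apply/subr0_eq/rnorm_le0.
  apply: (squeeze _ (2 * rnorm x)) => [|n].
    by rewrite mulr_ge0 ?rnorm_ge0.
  (* Iterate [n.+1] is compared with the recursion at [n], so that the terms in [B x] cancel. *)
  have -> : Y x - half *: (B x + Y (Y x)) = (Y x - sqrt_iter n.+1 x) -
      half *: ((Y (Y x) - sqrt_iter n (Y x)) + sqrt_iter n (Y x - sqrt_iter n x)).
    rewrite [sqrt_iter n.+1 x]/= (linear_funB (sqrt_iter_linear n)) subrKA.
    by rewrite -addrA -opprD -scalerDr addrACA subrr addr0.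
  rewrite (le_trans (rnormB _ _))// rnormZr ger0_norm//.
  have := rnormD (Y (Y x) - sqrt_iter n (Y x)) (sqrt_iter n (Y x - sqrt_iter n x)).
  have := Ydist n.+1 x; have := Ydist n (Y x); have := Yle x; have := ys n.
  have := sqrt_iter_norm n (Y x - sqrt_iter n x); have := Ydist n x.
  have [/andP[y0 y1] y2] := sqrt_majorant_bound n.
  have sn : 0 <= s - sqrt_majorant n by rewrite subr_ge0.
  have := ler_wpM2l sn (Yle x).
  have := ler_wpM2r (rnorm_ge0 x) y1.
  have := ler_wpM2r (rnorm_ge0 (Y x - sqrt_iter n x)) (le_trans y1 y2).
  lra.
Qed.

End Contraction.

(** With [|A x| <= c |x|], the operator [B = 1 - A / c] is a symmetric contraction, and
    [P = sqrt c (1 - Y)] satisfies [P^2 = c (1 - B) = A]. *)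
Lemma psd_sqrt_exists (A : H -> H) : BH A -> psd dot A ->
  exists P, [/\ BH P, psd dot P & P \o P = A].
Proof.
move=> BA pA; have lA := proj1 BA; have [c c0 Ac] := BH_bound BA.
have ci0 : 0 < c^-1 by rewrite invr_gt0.
pose B x := x - (c^-1)%:C%C *: A x.
have lB : linear B.
  move=> a x y; rewrite /B lA scalerDr opprD addrACA scalerBr; congr (_ - _ + _).
  by rewrite !scalerA mulrC.
have symB x y : rdot (B x) y = rdot x (B y).
  by rewrite /B rdotBl rdotBr rdotZl rdotZr psd_sym.
have Ble x : rnorm (B x) <= rnorm x.
  rewrite -(@ler_pXn2r _ 2) ?nnegrE ?rnorm_ge0// /B (rnorm_sqrB Hdot) rdotZr.
  rewrite rnormZr (gtr0_norm ci0) exprMn.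
  (* Positivity of [A] at [B x], with [<A (A x), A x> <= c |A x|^2], yields [|A x|^2 <= c <A x, x>],
     from which [|B x| <= |x|] follows. *)
  have := psd_rdot (B x) pA; rewrite /B (linear_funB lA) (linear_funZ lA).
  rewrite rdotBl !rdotBr !rdotZl !rdotZr rdotxx// (rdotC _ (A x) x).
  rewrite (psd_sym _ x lA pA) rdotxx// => AB.
  have AA : rdot (A (A x)) (A x) <= c * rnorm (A x) ^+ 2.
    by rewrite (le_trans (rdot_le Hdot _ _))// expr2 mulrA ler_wpM2r ?rnorm_ge0.
  have {}AA : c^-1 * rdot (A (A x)) (A x) <= rnorm (A x) ^+ 2.
    by rewrite mulrC ler_pdivrMr// mulrC.
  have := ler_wpM2l (ltW ci0) AA; have := psd_rdot x pA; rewrite rdotC; nra.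
have [Y [lY Yle symY YE]] := sqrt_iter_limit lB Ble symB.
pose P x := (Num.sqrt c)%:C%C *: (x - Y x).
have lP : linear P.
  move=> a x y; rewrite /P lY opprD addrACA -scalerBr scalerDr; congr (_ + _).
  by rewrite !scalerA mulrC.
have symP x y : rdot (P x) y = rdot x (P y).
  by rewrite /P rdotZl rdotZr rdotBl rdotBr symY.
exists P; split.
- apply: (@BH_intro _ _ _ (Num.sqrt c * 2)) => // x.
  rewrite /P rnormZr ger0_norm ?sqrtr_ge0// -mulrA ler_wpM2l ?sqrtr_ge0//.
  by have := rnormB x (Y x); have := Yle x; lra.
- move=> x; rewrite lecE /= Im_dot_real// eqxx /=.
  rewrite -/(redot _ _ _) /P rdotZl mulr_ge0 ?sqrtr_ge0// rdotBl rdotxx//.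
  have := rdot_le Hdot (Y x) x; have := Yle x; have := rnorm_ge0 x; nra.
- apply/funext => x /=; rewrite /P (linear_funZ lY) (linear_funB lY) -scalerBr.
  rewrite scalerA -rmorphM /= -expr2 sqr_sqrtr ?ltW//.
  have YY : Y (Y x) = Y x + Y x - B x.
    have -> : Y x + Y x = (2 : R)%:C%C *: Y x by rewrite rmorphMn /= scaler_nat mulr2n.
    by rewrite [X in _ *: X - _]YE scalerA -rmorphM /= divff// scale1r addrAC subrr add0r.
  have -> : x - Y x - (Y x - Y (Y x)) = x - B x.
    by rewrite opprB YY [_ - B x - _]addrAC addrK subrKA.
  by rewrite /B opprB addrC subrK scalerA -rmorphM /= divff ?gt_eqF// scale1r.
Qed.

End SquareRoot.

(** * The A-spectrum *)

(** Stability of lower bounds: moving the spectral parameter by less than [k] costs at most [k |y|],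
    which leaves [c - k >= k]. *)
Lemma rnorm_shift_ge (R : realType) (V : normedModType R[i]) (x y : V) (l : R[i])
    (c k : R) :
  c * rnorm y <= rnorm x -> complex.Re `|l| < k -> k + k <= c ->
  k * rnorm y <= rnorm (x + l *: y).
Proof.
move=> cy lk kc; have := rnormB (x + l *: y) (l *: y); rewrite addrK rnormZ.
have := ler_wpM2r (rnorm_ge0 y) kc; have := ler_wpM2r (rnorm_ge0 y) (ltW lk).
lra.
Qed.

Section ASpectrum.
Context (R : realType) (H : completeNormedModType R[i]).
Context (dot : {dot H for (@conjC R[i])}) (Hdot : induces_norm dot).
Local Notation rdot := (redot dot).
Local Notation adjoint := (adjoint dot).

Lemma adjointP T : BH T ->
  BH (adjoint T) /\ forall x y, dot (T x) y = dot x (adjoint T y).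
Proof.
move=> BT; apply: (@xgetPex _ (cst 0) [set S | BH S /\ _]).
have [c _ Tc] := BH_bound BT.
have BI : BH (@idfun H) by apply: (@BH_intro _ _ _ 1) => // x; rewrite mul1r.
(* The adjoint is the Douglas factor of [T] through the identity. *)
by have [G [BG _ TG]] := douglas_factor Hdot BT BI Tc; exists G.
Qed.

Lemma adjoint_scaleB (l : R[i]) T : BH T ->
  forall y, adjoint (fun x => l *: x - T x) y = conjC l *: y - adjoint T y.
Proof.
move=> BT y; apply: (dot_inj Hdot) => z.
rewrite -(proj2 (adjointP (BH_scaleB l BT))) dotBl dotZl (proj2 (adjointP BT)).
by rewrite dotBr dotZr conjCK.
Qed.

Context (A : H -> H) (BA : BH A) (Apsd : psd dot A).
Local Notation P := (sqrtop dot A).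

Lemma sqrtopP : [/\ BH P, psd dot P & P \o P = A].
Proof. exact: (xgetPex (cst 0) (psd_sqrt_exists Hdot BA Apsd)). Qed.

Let BP : BH P. Proof. by have [] := sqrtopP. Qed.
Let lP : linear P. Proof. exact: (proj1 BP). Qed.

Lemma sqrtop_sqr x : P (P x) = A x.
Proof. by have [_ _ PPA] := sqrtopP; rewrite -{3}PPA. Qed.

Lemma sqrtop_sym x y : dot (P x) y = dot x (P y).
Proof.
have [_ pP _] := sqrtopP.
by apply: (@eq_dot _ _ _ P idfun y (P y)) => // z; apply: psd_sym.
Qed.

Lemma seminormAE x : seminormA dot A x = (rnorm (P x))%:C%C.
Proof.
rewrite /seminormA -sqrtop_sqr sqrtop_sym -Hdot rnormE sqrCK//.
Qed.

(** Douglas factorization of [P T] through [P]: [<P T x, h> = <P x, G h>] says [T^* P = P G]. *)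
Lemma diamond_exists T (c : R) : BH T ->
  (forall x, rnorm (P (T x)) <= c * rnorm (P x)) ->
  exists S, [/\ BH S, adjoint T \o P = P \o S & range S `<=` closure (range P)].
Proof.
move=> BT Tc; have [G [BG Gcl GE]] := douglas_factor Hdot (BH_comp BP BT) BP Tc.
exists G; split=> //; apply/funext => h /=; apply: (dot_inj Hdot) => z.
by rewrite -(proj2 (adjointP BT)) -!sqrtop_sym -GE.
Qed.

(** If [T^* P x = P y], then [|<x, P T z>| = |<y, P z>| <= |y| |P z|] in real parts, and uniform
    boundedness over [z] with weight [|P z|] gives the constant. Conversely [T^* P = P S] yields the
    range inclusion. *)
Lemma BAhalfP T : BAhalf dot A T <->
  BH T /\ exists2 c : R, 0 <= c & forall x, rnorm (P (T x)) <= c * rnorm (P x).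
Proof.
split=> [[BT Tsub]|[BT [c _ Tc]]].
  split=> //; apply: (uniform_boundedness Hdot) => [x|x]; first exact: rnorm_ge0.
  have [|y _ Py] := Tsub (adjoint T (P x)); first by exists x.
  exists (rnorm y) => z.
  have -> : rdot x (P (T z)) = rdot y (P z).
    rewrite rdotC (rdotC _ y) /redot !sqrtop_sym (proj2 (adjointP BT)).
    by rewrite -[adjoint T (P x)]Py.
  exact: normr_rdot_le.
split=> //; have [S [_ TS _]] := diamond_exists BT Tc.
by rewrite TS => _ [x _ <-]; exists (S x).
Qed.

Lemma diamondP T : BAhalf dot A T ->
  BH (diamond dot A T) /\ forall x, adjoint T (P x) = P (diamond dot A T x).
Proof.
move=> /BAhalfP [BT [c _ Tc]].
have [BD TD _] := xgetPex (cst 0) (diamond_exists BT Tc).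
by split=> // x; have := congr1 (fun f => f x) TD.
Qed.

(* The inverse [S] is the Douglas factor of [P] through [V^* P]. *)
Lemma A_invertible_bounded_below V (c : R) : A <> cst 0 -> BAhalf dot A V -> 0 < c ->
  (forall x, c * rnorm (P x) <= rnorm (P (V x))) ->
  (forall x, c * rnorm (P x) <= rnorm (adjoint V (P x))) ->
  A_invertible dot A V.
Proof.
move=> A0 AV c0 Vc V'c; have [BV _] := AV.
have [BV' V'E] := adjointP BV.
have Pc x : rnorm (P x) <= c^-1 * rnorm ((adjoint V \o P) x).
  by rewrite mulrC ler_pdivlMr// mulrC; apply: V'c.
have [S [BS _ SE]] := douglas_factor Hdot BP (BH_comp BV' BP) Pc.
have PVS x : P (V (S x)) = P x.
  apply: (dot_inj Hdot) => z; rewrite -!sqrtop_sym (SE z x) /=.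
  by rewrite dotC V'E -dotC.
have PSV x : P (S (V x)) = P x.
  (* [P V] annihilates [S V x - x] because [P V S = P]; the lower bound on [V] then makes [P]
     annihilate it. *)
  apply/subr0_eq/rnorm_le0; rewrite -(linear_funB lP) -(ler_pM2l c0) mulr0.
  by rewrite (le_trans (Vc _))// (linear_funB (proj1 BV)) (linear_funB lP) PVS subrr rnorm0.
have AVS : A \o V \o S = A by apply/funext => x /=; rewrite -!sqrtop_sqr PVS.
have ASV : A \o S \o V = A by apply/funext => x /=; rewrite -!sqrtop_sqr PSV.
have A_0 : A 0 = 0 := linear_fun0 (proj1 BA).
split=> // [V0|]; first by apply: A0; rewrite -AVS V0; apply/funext => x /=.
exists S; split=> // [|S0].
  apply/BAhalfP; split=> //; exists c^-1 => [|x]; first by rewrite invr_ge0 ltW.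
  by rewrite mulrC ler_pdivlMr// mulrC -[P x]PVS.
by apply: A0; rewrite -ASV S0; apply/funext => x /=.
Qed.

Lemma sigmaA_appN_bounded_below T (l : R[i]) : BH T -> ~ sigmaA_app dot A T l ->
  exists2 c : R, 0 < c & forall x, c * rnorm (P x) <= rnorm (P (T x - l *: x)).
Proof.
move=> BT; have lT := proj1 BT; apply: contra_notP => Tl.
have /choice [x xP] : forall n : nat, exists x,
    rnorm (P (T x - l *: x)) < n.+1%:R^-1 * rnorm (P x).
  move=> n; apply: contrapT => nx; apply: Tl.
  exists n.+1%:R^-1 => [|x]; first by rewrite invr_gt0.
  by rewrite leNgt; apply/negP => ?; apply: nx; exists x.
(* The strict inequality in [xP] excludes [P (x n) = 0], so the [x n] can be normalised into
   approximate eigenvectors. *)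
have Px n : 0 < rnorm (P (x n)).
  rewrite -(@pmulr_rgt0 _ n.+1%:R^-1) ?invr_gt0//.
  exact: le_lt_trans (rnorm_ge0 _) (xP n).
exists (fun n => ((rnorm (P (x n)))^-1)%:C%C *: x n); split=> [n|].
  rewrite seminormAE (linear_funZ lP) rnormZr ger0_norm ?invr_ge0 ?ltW//.
  by rewrite mulVf ?gt_eqF.
apply: rnorm_cvg0 => e e0; exists (Num.truncn e^-1) => n n0.
rewrite seminormAE (linear_funZ lT) scalerA mulrC -scalerA -scalerBr (linear_funZ lP).
rewrite rnormZr ger0_norm ?invr_ge0 ?ltW//.
rewrite [X in X < _](_ : _ = (rnorm (P (x n)))^-1 * rnorm (P (T (x n) - l *: x n))); last first.
  rewrite /rnorm ger0_norm//.
  by rewrite lecR mulr_ge0 ?invr_ge0 ?rnorm_ge0.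
rewrite mulrC ltr_pdivrMr// (lt_trans (xP n))// ltr_pM2r//.
rewrite -ltf_pV2 ?posrE ?invrK ?invr_gt0//.
by rewrite (lt_le_trans (truncnS_gt _))// ler_nat.
Qed.

End ASpectrum.

Theorem theorem2p20 (R : realType) (H : completeNormedModType R[i])
    (dot : {dot H for (@conjC R[i])}) (Hdot : induces_norm dot)
    (A : H -> H) (BA : BH A) (Apsd : psd dot A) (A_neq0 : A <> cst 0)
    (T : H -> H) (BT : BAhalf dot A T) :
  boundary (sigmaA dot A T) `<=`
    sigmaA_app dot A T `|` conj_set (sigmaA_app dot A (diamond dot A T)).
Proof.
move=> l [cl_l _]; apply: contrapT => /not_orP[lT lD].
have [BHT [t t0 Tt]] := (BAhalfP Hdot BA Apsd T).1 BT.
have [BD TD] := diamondP Hdot BA Apsd BT.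
have lP : linear (sqrtop dot A) by have [[]] := sqrtopP Hdot BA Apsd.
have [c c0 Tc] := sigmaA_appN_bounded_below Hdot BA Apsd BHT lT.
have [|d d0 Dd] := @sigmaA_appN_bounded_below _ _ _ Hdot _ BA Apsd _ (conjC (l : R[i])) BD.
  by move=> lD'; apply: lD; exists (conjC (l : R[i])); rewrite //= conjCK.
(* A shift of the parameter by less than [k] keeps both lower bounds at [k]. *)
set k := Num.min c d / 2.
have k0 : 0 < k by rewrite divr_gt0// lt_min c0.
have [kc kd] : k + k <= c /\ k + k <= d by rewrite -splitr !ge_min !lexx orbT.
(* [m] is a point of the spectrum within [k] of [l]; showing [m - T] to be A-invertible contradicts
   this. *)
have [m /= + lm] := (rnorm_closureP _ _).1 cl_l k k0.
apply; apply: (@A_invertible_bounded_below _ _ _ Hdot _ BA Apsd _ k) => //.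
- apply/(BAhalfP Hdot BA Apsd); split; first exact: BH_scaleB.
  exists (complex.Re `|m : R[i]| + t) => [|x].
    by rewrite addr_ge0// -lecR RRe_real ?normr_real ?normr_ge0.
  rewrite (linear_funB lP) (linear_funZ lP) (le_trans (rnormB _ _))//.
  by rewrite mulrDl rnormZ lerD2l.
- move=> x.
  have -> : (m : R[i]) *: x - T x = - ((T x - (l : R[i]) *: x) + ((l : R[i]) - m) *: x).
    by rewrite scalerBl addrA subrK opprB.
  rewrite (linear_funN lP) rnormN (linear_funD lP) (linear_funZ lP).
  exact: rnorm_shift_ge (Tc x) lm kc.
(* The adjoint of [m - T] applied to [P x] is [P] applied to [conjC m *: x - diamond dot A T x], so
   the bound for [diamond] at [conjC l] applies. *)
- move=> x; rewrite adjoint_scaleB// TD -(linear_funZ lP) -(linear_funB lP).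
  have -> : conjC (m : R[i]) *: x - diamond dot A T x =
      - ((diamond dot A T x - conjC (l : R[i]) *: x) + conjC ((l : R[i]) - m) *: x).
    by rewrite rmorphB scalerBl addrA subrK opprB.
  rewrite (linear_funN lP) rnormN (linear_funD lP) (linear_funZ lP).
  by apply: rnorm_shift_ge (Dd x) _ kd; rewrite /rnorm norm_conjC.
Qed.
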